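(* Let $p \geq 1$, $l \geq 1$, $q \geq 2$, and $n \geq 0$ be integers. Let $\mathcal{M}$ be a family (set) of partial Meshalkin sequences of length $p$ in $\mathbb{P}^{n-1}(q)$ such that, for each $k \in \{1,\dots,p\}$, the set $\mathcal{M}_k = \{ a_k : (a_1,\dots,a_p)\in\mathcal{M}\}$ contains no chain of length $l$. For $a=(a_1,\dots,a_p)\in\mathcal{M}$ write $\hat a=a_1\vee\dots\vee a_p$. Then (a) $\displaystyle \sum_{ a \in \mathcal{M} } \frac{1}{ \left[ {n \atop r(\hat a)} \right] \left[ {r(\hat a) \atop r(a)} \right] q^{ s_2 (r(a)) } } \leq l^p$, and (b) $|\mathcal{M}|$ is at most equal to the sum of the $l^p$ largest amongst the quantities $\left[ {n \atop \alpha} \right] q^{ s_2(\alpha) }$ for $\alpha = ( \alpha_1 , \dots , \alpha_{p+1} )$ ranging over $(p+1)$-tuples of integers with all $\alpha_k \geq 0$ and $\alpha_1 + \dots + \alpha_{p+1} = n$.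
   Context: $\mathbb{P}^{n-1}(q)$ denotes a (finite) projective geometry of order $q$ and rank $n$ (dimension $n-1$): a set of points and lines such that any two distinct points lie on a unique line, every line has exactly $q+1$ points, and the Veblen–Young axiom holds. By convention it is empty if $n=0$, a single point if $n=1$, and a line of $q+1$ points if $n=2$. A flat (subspace) is a set of points containing, with any two distinct points, the whole line through them. The geometry is regarded as its lattice of flats ordered by inclusion, with $\hat 0=\varnothing$, $\hat 1$ the whole set of points, and join $\vee$ (the flat generated by the union). The rank of a flat $a$ is $r(a)=\dim a+1$ (so $r(\hat 0)=0$, points have rank $1$, lines have rank $2$, $r(\hat 1)=n$). A partial Meshalkin sequence of length $p$ in $\mathbb{P}^{n-1}(q)$ is a sequence $a=(a_1,\dots,a_p)$ of flats with $r(a_1\vee\dots\vee a_p)=r(a_1)+\dots+r(a_p)$ (the join need not be $\hat 1$). For such a sequence write $r(a)=(r(a_1),\dots,r(a_p))$. A chain of length $l$ is a chain of $l+1$ distinct, pairwise comparable flats (so containing no chain of length $1$ means being an antichain). For $m \ge 0$, $m!_q=(q^m-1)(q^{m-1}-1)\cdots(q-1)$, with $0!_q=1$. For $0\le k\le m$, $\left[ {m \atop k} \right]=\frac{m!_q}{k!_q(m-k)!_q}$. For a tuple $\alpha=(\alpha_1,\dots,\alpha_t)$ of nonnegative integers with sum $m$, $\left[ {m \atop \alpha} \right]=\frac{m!_q}{\alpha_1!_q\cdots\alpha_t!_q}$. Also $s_2(\alpha)=\sum_{i<j}\alpha_i\alpha_j$. In (a), $\left[ {n \atop r(\hat a)}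 \right]$ is the Gaussian (binomial) coefficient with the single lower integer $r(\hat a)$, and $\left[ {r(\hat a) \atop r(a)} \right]$ is the multinomial coefficient with lower tuple $r(a)$. The ''$l^{p}$ largest amongst the quantities'' is understood with the quantities indexed by the tuples $\alpha$ (equal values for different $\alpha$ are counted separately); if there are fewer than $l^{p}$ tuples $\alpha$, the sum is over all of them. *)

(* Defs.v *)
From mathcomp Require Import all_boot all_order all_algebra.
Set Implicit Arguments.
Unset Strict Implicit.
Unset Printing Implicit Defensive.
Import Order.TTheory GRing.Theory Num.Theory.
Local Open Scope ring_scope.

Section Geometry.

(* An incidence structure on a finite type of points; a line is identified
   with the set of its points. *)
Variables (T : finType) (L : {set {set T}}).

Definition is_flat (X : {set T}) : bool :=
  [forall x in X, forall y in X, (x != y) ==>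
     [forall l in L, (x \in l) && (y \in l) ==> (l \subset X)]].

(* The flat generated by X; [set: T] is always a flat containing X. *)
Definition flat_gen (X : {set T}) : {set T} :=
  \bigcap_(F : {set T} | is_flat F && (X \subset F)) F.

(* dim X + 1, i.e. the least number of points that generate the flat X.
   Meaningful only for a flat X, which is then itself a candidate. *)
Definition rank (X : {set T}) : nat :=
  #|[arg min_(B < X | flat_gen B == X) #|B|]|.

Definition veblen_young : Prop :=
  forall (a b c d : T) (lab lcd lac lbd : {set T}),
    uniq [:: a; b; c; d] ->
    lab \in L -> a \in lab -> b \in lab ->
    lcd \in L -> c \in lcd -> d \in lcd ->
    lac \in L -> a \in lac -> c \in lac ->
    lbd \in L -> b \in lbd -> d \in lbd ->
    (exists x, (x \in lab) && (x \in lcd)) ->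
    exists y, (y \in lac) && (y \in lbd).

(* For q >= 2, the last field forces there to be no point if n = 0, a single
   point if n = 1, and a single line if n = 2. *)
Record is_projective_geometry (q n : nat) : Prop := IsProjectiveGeometry {
  pg_line : forall x y : T, x != y ->
    exists! l : {set T}, l \in L /\ (x \in l /\ y \in l);
  pg_order : forall l : {set T}, l \in L -> #|l| = q.+1;
  pg_veblen_young : veblen_young;
  pg_rank : rank [set: T] = n
}.

Definition join_seq (p : nat) (a : {ffun 'I_p -> {set T}}) : {set T} :=
  flat_gen (\bigcup_(k < p) a k).

Definition partial_meshalkin (p : nat) (a : {ffun 'I_p -> {set T}}) : Prop :=
  (forall k : 'I_p, is_flat (a k)) /\
  rank (join_seq a) = (\sum_(k < p) rank (a k))%N.

Definition rank_seq (p : nat) (a : {ffun 'I_p -> {set T}}) : 'I_p -> nat :=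
  fun k => rank (a k).

End Geometry.

Definition is_chain_of_length (T : finType) (l : nat) (C : {set {set T}}) : bool :=
  (#|C| == l.+1) &&
  [forall X in C, forall Y in C, (X \subset Y) || (Y \subset X)].

Definition component (T : finType) (p : nat)
    (M : {set {ffun 'I_p -> {set T}}}) (k : 'I_p) : {set {set T}} :=
  [set (a : {ffun 'I_p -> {set T}}) k | a in M].

(* Not divided by (q - 1)^m, unlike the usual q-factorial. *)
Definition qfact (q m : nat) : rat := \prod_(1 <= i < m.+1) (q%:R ^+ i - 1).

Definition qbinom (q m k : nat) : rat :=
  qfact q m / (qfact q k * qfact q (m - k)).

(* Used only when alpha sums to m. *)
Definition qmultinom (q m t : nat) (alpha : 'I_t -> nat) : rat :=
  qfact q m / \prod_(i < t) qfact q (alpha i).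

Definition s2 (t : nat) (alpha : 'I_t -> nat) : nat :=
  (\sum_(i < t) \sum_(j < t | (i < j)%N) alpha i * alpha j)%N.

(* Repeated values are counted with multiplicity; if s has fewer than N
   entries, this is the sum of all of them. *)
Definition sum_largest (N : nat) (s : seq rat) : rat :=
  \sum_(x <- take N (sort (fun x y : rat => y <= x) s)) x.

(* The t-tuples of nonnegative integers with sum n; the entries are then at
   most n, so they may be taken in 'I_n.+1. *)
Definition compositions (t n : nat) : {set {ffun 'I_t -> 'I_n.+1}} :=
  [set alpha : {ffun 'I_t -> 'I_n.+1} | (\sum_(i < t) alpha i)%N == n].

(* Main.v *)
Require Import Defs.
From mathcomp Require Import all_boot all_order all_algebra.
From mathcomp Require Import zify ring lra.
Import Order.TTheory GRing.Theory Num.Theory.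
Set Implicit Arguments.
Unset Strict Implicit.
Unset Printing Implicit Defensive.

(** A double count of ordered bases proves the inequality (a).

    Let a basis be an n-tuple of points that spans the whole geometry.  Call it
    adapted to a = (a_1, ..., a_p) if its first r(a_1) points span a_1, the
    next r(a_2) points span a_2, and so on; the last n - r(a_1) - ... - r(a_p)
    points are arbitrary.

    - Each basis is adapted to at most l^p members of M.  Its initial segments
      span a chain of flats, so there are at most l choices of a_1 in M_1; once
      a_1 is chosen, the next block begins at a known place, and its initial
      segments again span a chain, which leaves at most l choices of a_2, and
      so on (card_adapted).

    - The number of bases adapted to a partial Meshalkin sequence a depends only
      on the ranks.  Concatenated bases of the a_k have as many points as the
      rank of the join that they span, hence are independent, and extend to
      bases of the geometry in a number of ways given by a product
      (count_adapted_bases).  With C(m) standing for m(m-1)/2, the number of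
      bases of a flat of rank m is q^C(m) m!_q / (q-1)^m.  The identity
      C(m_1 + ... + m_t) = C(m_1) + ... + C(m_t) + s_2(m) then shows that the
      fraction of all bases that are adapted to a is exactly
      1 / ([n, r] [r, r(a)] q^s_2(r(a))), where r is the rank of the join
      (weightE).

    Only one geometric fact is needed: a point x outside a flat u generates with
    u the union of the lines that join x to the points of u.  This is where the
    Veblen-Young axiom enters (cone_flat).  The generated flat then has
    1 + q |u| points, so k points span at most 1 + q + ... + q^(k-1) points,
    with equality exactly when they are independent (card_span, indep_cons).  Rank,
    independence and exchange can all be read off from cardinalities.

    For (b), sort the members of M by the composition
    alpha = (r(a_1), ..., r(a_p), n - r) of n, and let y_alpha be the number of
    members of type alpha, divided by V_alpha = [n, alpha] q^s_2(alpha).  Flats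
    of equal rank form an antichain, so (a) with l = 1 yields y_alpha <= 1,
    while (a) for M yields that the y_alpha sum up to at most l^p.  Under these
    constraints the sum of the y_alpha V_alpha, which is |M|, is largest when
    all the weight lies on the l^p largest V_alpha (ler_sum_largest). *)

(** * Sums over tuples *)

(** The summand is a function of the underlying list, so that tuples of
   propositionally equal lengths need no casts. *)
Lemma sum_tuple0 (T : finType) (F : seq T -> nat) :
  \sum_(t : 0.-tuple T) F t = F [::].
Proof.
by rewrite (eq_bigr (fun _ => F [::])) => [|t _];
  rewrite ?sum_nat_const ?card_tuple ?expn0 ?mul1n // tuple0.
Qed.

Lemma sum_tupleS (T : finType) k (F : seq T -> nat) :
  \sum_(t : k.+1.-tuple T) F t = \sum_x \sum_(t : k.-tuple T) F (x :: t).
Proof.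
rewrite pair_big /=.
rewrite (reindex (fun xt : T * k.-tuple T => [tuple of xt.1 :: xt.2])) //=.
exists (fun t : k.+1.-tuple T => (thead t, [tuple of behead t])) => [[x t]|t] _ /=.
  by rewrite theadE; congr (_, _); apply: val_inj.
by rewrite -tuple_eta.
Qed.

Lemma sum_tupleD (T : finType) j k (F : seq T -> nat) :
  \sum_(t : (j + k).-tuple T) F t
    = \sum_(u : j.-tuple T) \sum_(v : k.-tuple T) F (u ++ v).
Proof.
elim: j F => [|j IH] F.
  by rewrite (sum_tuple0 (fun u => \sum_(v : k.-tuple T) F (u ++ v))).
rewrite addSn sum_tupleS.
rewrite (sum_tupleS _ (fun u => \sum_(v : k.-tuple T) F (u ++ v))).
by apply: eq_bigr => x _; apply: (IH (fun s => F (x :: s))).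
Qed.

(** * The closure operator of an incidence structure *)

Section Closure.
Variables (T : finType) (L : {set {set T}}).
Local Notation cl := (flat_gen L).
Implicit Types (X Y F : {set T}) (x y : T).

Lemma flatP F :
  reflect (forall x y l, x \in F -> y \in F -> x != y -> l \in L ->
             x \in l -> y \in l -> l \subset F)
          (is_flat L F).
Proof.
apply: (iffP forall_inP) => [H x y l xF yF xy lL xl yl | H x xF].
  by move: (H x xF) => /forall_inP /(_ y yF); rewrite xy => /forall_inP /(_ l lL);
     rewrite xl yl.
apply/forall_inP => y yF; apply/implyP => xy; apply/forall_inP => l lL.
by apply/implyP => /andP[xl yl]; apply: H xy lL xl yl.
Qed.

Lemma flat_gen_flat X : is_flat L (cl X).
Proof.
apply/flatP => x y l /bigcapP xX /bigcapP yX xy lL xl yl.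
apply/bigcapsP => F /[dup] HF /andP[/flatP fF _].
exact: fF (xX F HF) (yX F HF) xy lL xl yl.
Qed.

Lemma sub_flat_gen X : X \subset cl X.
Proof. by apply/bigcapsP => F /andP[]. Qed.

Lemma flat_gen_min F X : is_flat L F -> X \subset F -> cl X \subset F.
Proof. by move=> fF XF; apply: bigcap_inf; rewrite fF. Qed.

Lemma flat_gen_id F : is_flat L F -> cl F = F.
Proof. by move=> fF; apply/eqP; rewrite eqEsubset sub_flat_gen flat_gen_min. Qed.

Lemma flat_genS X Y : X \subset Y -> cl X \subset cl Y.
Proof.
move=> XY; apply: flat_gen_min (flat_gen_flat Y) _.
exact: subset_trans XY (sub_flat_gen Y).
Qed.

Lemma flat_genUl X Y : cl (cl X :|: Y) = cl (X :|: Y).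
Proof.
apply/eqP; rewrite eqEsubset [X in _ && X]flat_genS ?setSU ?sub_flat_gen // andbT.
apply: flat_gen_min (flat_gen_flat _) _; rewrite subUset flat_genS ?subsetUl //=.
exact: subset_trans (subsetUr X Y) (sub_flat_gen _).
Qed.

Lemma flat_genUr X Y : cl (X :|: cl Y) = cl (X :|: Y).
Proof. by rewrite setUC flat_genUl setUC. Qed.

Lemma flat_set0 : is_flat L set0.
Proof. by apply/flatP => x y l; rewrite inE. Qed.

Lemma flat_gen0 : cl set0 = set0.
Proof. exact: flat_gen_id flat_set0. Qed.

Lemma flat_setT : is_flat L setT.
Proof. by apply/flatP => x y l *; apply: subsetT. Qed.

End Closure.

(** * Numbers of points *)

(** The number of points of a flat of rank [k]. *)
Definition gauss q k := \sum_(i < k) q ^ i.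

Lemma gauss0 q : gauss q 0 = 0.
Proof. exact: big_ord0. Qed.

Lemma gaussS q k : gauss q k.+1 = 1 + q * gauss q k.
Proof.
rewrite /gauss big_ord_recl expn0 big_distrr /=; congr (_ + _).
by apply: eq_bigr => i _; rewrite expnS.
Qed.

Lemma gauss_ltS q k : 0 < q -> gauss q k < gauss q k.+1.
Proof.
by move=> q0; rewrite /gauss big_ord_recr /= -addn1 leq_add2l expn_gt0 q0.
Qed.

Lemma leq_gauss q j k : 0 < q -> (gauss q j <= gauss q k) = (j <= k).
Proof.
move=> q0; have mono a b : a < b -> gauss q a < gauss q b.
  by apply: (homo_ltn ltn_trans) => i; apply: gauss_ltS.
case: (ltngtP j k) => [/mono/ltnW -> //|/mono|->]; last by rewrite leqnn.
by move=> lt_kj; apply/negbTE; rewrite -ltnNge.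
Qed.

(** * The flat generated by a flat and a point *)

Section Geometry.
Variables (T : finType) (L : {set {set T}}) (q n : nat).
Hypotheses (q_gt1 : 1 < q) (pg : is_projective_geometry L q n).
Local Notation cl := (flat_gen L).
Implicit Types (u X Y l : {set T}) (x y z : T) (s t : seq T).

Let q_gt0 : 0 < q. Proof. exact: ltnW. Qed.

Definition line x y : {set T} :=
  odflt set0 [pick l in L | (x \in l) && (y \in l)].

Lemma lineP x y : x != y -> [/\ line x y \in L, x \in line x y & y \in line x y].
Proof.
move=> xy; rewrite /line; case: pickP => [l /and3P[] //|].
have [l [[lL [xl yl]] _]] := pg_line pg xy.
by move=> /(_ l); rewrite lL xl yl.
Qed.

Lemma line_uniq x y l : x != y -> l \in L -> x \in l -> y \in l -> l = line x y.
Proof.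
move=> xy lL xl yl; have [k [_ uk]] := pg_line pg xy.
have [h1 h2 h3] := lineP xy.
by rewrite -(uk l) // -(uk (line x y)).
Qed.

Lemma lines_eq l l' x y : x != y -> l \in L -> l' \in L -> x \in l -> y \in l ->
  x \in l' -> y \in l' -> l = l'.
Proof. by move=> xy *; rewrite (@line_uniq x y l) // (@line_uniq x y l'). Qed.

(** [x] is added separately because the union is empty when [u] is. *)
Definition cone x u : {set T} := x |: \bigcup_(y in u) line x y.

Lemma veblen a b c d x l l' : uniq [:: a; b; c; d] ->
  l \in L -> a \in l -> b \in l -> l' \in L -> c \in l' -> d \in l' -> x \in l -> x \in l' ->
  exists2 y, y \in line a c & y \in line b d.
Proof.
move=> U lL al bl lL' cl' dl' xl xl'.
have [ac bd] : a != c /\ b != d.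
  by move: U; rewrite /= !inE !negb_or => /and4P[/and3P[_ -> _] /andP[_ ->]].
have [acL a1 c1] := lineP ac; have [bdL b1 d1] := lineP bd.
have [|y /andP[]] := pg_veblen_young pg U lL al bl lL' cl' dl' acL a1 c1 bdL b1 d1.
  by exists x; rewrite xl.
by exists y.
Qed.

(** Let [z] lie on the line through two points [a] and [b] of the cone, where
    [a] is on the line from [x] to [y1] and [b] on the line from [x] to [y2],
    with [y1] and [y2] in [u].  Veblen-Young is applied twice.  The lines [az]
    and [x y2] meet in [b], so [ax], which is the line [x y1], meets [z y2].
    Hence [x y1] and [z y2] meet, so [xz] meets [y1 y2].  That intersection is
    a point of [u] whose line to [x] contains [z].  All the other cases are
    degenerate. *)
Lemma cone_flat x u : is_flat L u -> x \notin u -> is_flat L (cone x u).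
Proof.
move=> /flatP fu xu.
have nex y : y \in u -> x != y by apply: contraTneq => <-.
have inc y z : y \in u -> z \in line x y -> z \in cone x u.
  by move=> yu zl; rewrite !inE; apply/orP; right; apply/bigcupP; exists y.
have linex b l : b \in cone x u -> b != x -> l \in L -> x \in l -> b \in l ->
    l \subset cone x u.
  rewrite !inE => /orP[/eqP-> |/bigcupP[y yu bl]]; first by rewrite eqxx.
  move=> bx lL xl bl'; have [h1 h2 h3] := lineP (nex y yu).
  rewrite (@lines_eq l (line x y) b x) //; apply/subsetP => z; exact: inc.
apply/flatP => a b l aC bC ab lL al bl.
have [ax|ax] := eqVneq a x; first by apply: (linex b); rewrite // -?ax // eq_sym.
have [bx|bx] := eqVneq b x; first by apply: (linex a); rewrite // -bx.
have [xl|xl] := boolP (x \in l); first exact: (linex a).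
move: (aC) (bC); rewrite !inE (negbTE ax) (negbTE bx) /=.
move=> /bigcupP[y1 y1u a1] /bigcupP[y2 y2u b2].
have [l1L x1 y11] := lineP (nex y1 y1u); have [l2L x2 y22] := lineP (nex y2 y2u).
apply/subsetP => z zl.
have [->//|za] := eqVneq z a.
have inu w : w \in u -> w \in cone x u.
  by move=> wu; apply: (inc w) => //; case: (lineP (nex w wu)).
have [/inu//|zu] := boolP (z \in u).
have zx : z != x by apply: contraNneq xl => <-.
have zy1 : z != y1 by apply: contraNneq zu => ->.
have zy2 : z != y2 by apply: contraNneq zu => ->.
have y12 : y1 != y2.
  apply: contraNneq xl => e; rewrite (@lines_eq l (line x y1) a b) //; by rewrite e.
have ay2 : a != y2.
  apply: contraNneq xu => e.
  apply: (subsetP (fu y1 y2 (line x y1) _ _ _ _ _ _)) => //.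
  by rewrite -e.
have [|v v1 v2] := @veblen a z x y2 b l (line x y2) _ lL al zl l2L x2 y22 bl b2.
  by rewrite /= !inE !negb_or andbT (eq_sym a z) za ax ay2 zx zy2 nex.
have [axL _ _] := lineP ax.
have e1 : line a x = line x y1.
  by apply: (@lines_eq _ _ a x) => //; case: (lineP ax).
rewrite e1 in v1; have [zyL zz zy] := lineP zy2.
have [|w w1 w2] := @veblen x y1 z y2 v (line x y1) (line z y2) _
                     l1L x1 y11 zyL zz zy v1 v2.
  rewrite /= !inE !negb_or andbT nex // (eq_sym x z) zx nex //.
  by rewrite (eq_sym y1 z) zy1 y12 zy2.
have [y12L y121 y122] := lineP y12.
have wu : w \in u by apply: (subsetP (fu y1 y2 (line y1 y2) _ _ _ _ _ _)) w2.
have xz : x != z by rewrite eq_sym.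
have [xzL xz1 xz2] := lineP xz; have [xwL xw1 xw2] := lineP (nex w wu).
apply: (inc w) => //; rewrite -(@lines_eq (line x z) (line x w) x w) //; exact: nex.
Qed.

Lemma flat_gen_cone x u : is_flat L u -> x \notin u -> cl (x |: u) = cone x u.
Proof.
move=> fu xu; have nex y : y \in u -> x != y by apply: contraTneq => <-.
apply/eqP; rewrite eqEsubset flat_gen_min ?cone_flat //=.
  have /flatP fJ := flat_gen_flat L (x |: u).
  have /subsetP sJ := sub_flat_gen L (x |: u).
  rewrite subUset sub1set sJ ?setU11 //=; apply/bigcupsP => y yu.
  have [h1 h2 h3] := lineP (nex y yu).
  by apply: (fJ x y) => //; rewrite ?nex ?sJ ?setU11 ?setU1r.
apply: setUS; apply/subsetP => y yu; apply/bigcupP; exists y => //.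
by case: (lineP (nex y yu)).
Qed.

(** The lines from [x] to the points of [u] are distinct, since a line with two
    points in [u] lies in [u]; they pairwise share only [x], and each has [q]
    further points. *)
Lemma card_cone x u : is_flat L u -> x \notin u -> #|cone x u| = (1 + q * #|u|)%N.
Proof.
move=> /flatP fu xu; have nex y : y \in u -> x != y by apply: contraTneq => <-.
pose F y := if y \in u then line x y :\ x else set0.
have xF y : x \notin F y by rewrite /F; case: ifP; rewrite !inE ?eqxx.
have eF : cone x u = x |: \bigcup_y F y.
  apply/setP => z; rewrite !inE; case: eqVneq => //= zx.
  apply/bigcupP/bigcupP => [[y yu zy]|[y _]].
    by exists y; rewrite // /F yu !inE zx.
  by rewrite /F; case: ifP => [yu /setD1P[_ zy]|_]; [exists y | rewrite inE].
rewrite eF cardsU1; have -> : x \notin \bigcup_y F y.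
  by apply/bigcupP => -[y _]; apply/negP.
congr (_ + _); rewrite -sum1_card partition_disjoint_bigcup => [|y y' yy'].
  rewrite -sum1_card big_distrr [RHS]big_mkcond /=; apply: eq_bigr => y _.
  rewrite sum1_card /F; case: ifP => [yu|]; last by rewrite cards0.
  have [h1 h2 _] := lineP (nex y yu).
  by have := cardsD1 x (line x y); rewrite h2 (pg_order pg h1) add1n muln1 => -[].
rewrite disjoints_subset; apply/subsetP => z; rewrite inE /F.
case: (boolP (y \in u)) => [yu|_]; last by rewrite in_set0.
case: (boolP (y' \in u)) => [y'u|_]; last by rewrite in_set0.
rewrite !inE => /andP[zx z1]; rewrite zx /=; apply/negP => z2.
have [h1 h2 h3] := lineP (nex y yu); have [h4 h5 h6] := lineP (nex y' y'u).
have e : line x y = line x y' by apply: (@lines_eq _ _ z x).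
have : x \in u by apply: (subsetP (fu y y' _ _ _ yy' h1 h3 _)); rewrite ?e.
by rewrite (negbTE xu).
Qed.

(** * Independence and rank *)

Definition span s := cl [set:: s].

Lemma span_flat s : is_flat L (span s). Proof. exact: flat_gen_flat. Qed.

Lemma span_cons x s : span (x :: s) = cl (x |: span s).
Proof. by rewrite /span set_cons flat_genUr. Qed.

Lemma span_cat s t : span (s ++ t) = cl (span s :|: span t).
Proof.
rewrite flat_genUl flat_genUr /span; congr cl.
by apply/setP => x; rewrite !inE mem_cat.
Qed.

Lemma eq_span s t : s =i t -> span s = span t.
Proof. by move=> st; congr cl; apply/setP => x; rewrite !inE st. Qed.

Lemma card_span_cons x s :
  #|span (x :: s)| = if x \in span s then #|span s| else 1 + q * #|span s|.
Proof.
rewrite span_cons; case: ifP => [xs|/negbT xs].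
  by rewrite (setUidPr _) ?sub1set // flat_gen_id ?span_flat.
by rewrite flat_gen_cone ?span_flat // card_cone ?span_flat.
Qed.

Lemma card_span s : #|span s| <= gauss q (size s).
Proof.
elim: s => [|x s IH]; first by rewrite /span set_nil flat_gen0 cards0.
rewrite card_span_cons /=; case: ifP => _.
  by apply: leq_trans IH _; rewrite leq_gauss.
by rewrite gaussS leq_add2l leq_mul2l IH orbT.
Qed.

(** Independence is defined as equality in [card_span].  That makes it
    visibly invariant under permutations, and [indep_cons] recovers the usual
    description; exchange is a consequence of the two. *)
Definition indep s := #|span s| == gauss q (size s).

Lemma indep_cons x s : indep (x :: s) = (x \notin span s) && indep s.
Proof.
rewrite /indep card_span_cons /=; case: ifP => _ /=.
  apply/negbTE; rewrite neq_ltn; apply/orP; left.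
  exact: leq_ltn_trans (card_span s) (gauss_ltS _ q_gt0).
by rewrite gaussS eqn_add2l eqn_pmul2l.
Qed.

Lemma indep_nil : indep [::].
Proof. by rewrite /indep /span set_nil flat_gen0 cards0 gauss0. Qed.

Lemma indep_perm s t : perm_eq s t -> indep s = indep t.
Proof.
by move=> st; rewrite /indep (perm_size st) (eq_span (perm_mem st)).
Qed.

Lemma indep_basis s : exists2 t, indep t & span t = span s.
Proof.
elim: s => [|x s [t it st]]; first by exists [::]; rewrite ?indep_nil.
have [xs|xs] := boolP (x \in span s).
  exists t; rewrite // st span_cons (setUidPr _) ?sub1set //.
  by rewrite flat_gen_id ?span_flat.
by exists (x :: t); rewrite ?indep_cons ?st ?xs // !span_cons st.
Qed.

(** A generating set of least size and an independent generating list have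
    equally many points: the first bounds the cardinality of [X] from above by
    [card_span], the second attains it. *)
Lemma card_flat X : is_flat L X -> #|X| = gauss q (rank L X).
Proof.
move=> fX; rewrite /rank; case: arg_minnP => [|B /eqP BX Bmin].
  by rewrite flat_gen_id.
have eB : span (enum B) = X.
  by rewrite -[RHS]BX; congr cl; apply/setP => x; rewrite inE mem_enum.
apply/eqP; rewrite eqn_leq; apply/andP; split.
  by have := card_span (enum B); rewrite eB -cardE.
have [t /eqP it st] := indep_basis (enum B).
rewrite -[X in _ <= #|pred_of_set X|]eB -st it leq_gauss //.
have tB : #|B| <= #|[set:: t]| by apply: Bmin; apply/eqP; rewrite -[RHS]eB.
by apply: leq_trans tB _; rewrite cardsE card_size.
Qed.

Lemma indep_rank s : indep s = (size s == rank L (span s)).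
Proof.
by rewrite /indep card_flat ?span_flat // !eqn_leq !leq_gauss // andbC.
Qed.

Lemma card_points : #|T| = gauss q n.
Proof. by rewrite -cardsT card_flat ?flat_setT // (pg_rank pg). Qed.

Lemma rank_le X : is_flat L X -> rank L X <= n.
Proof.
by move=> fX; rewrite -(leq_gauss _ _ q_gt0) -card_flat // -card_points max_card.
Qed.

Lemma rank_inj X Y : is_flat L X -> is_flat L Y -> X \subset Y ->
  rank L X = rank L Y -> X = Y.
Proof.
move=> fX fY XY rXY; apply/eqP; rewrite eqEcard XY.
by rewrite (card_flat fX) (card_flat fY) rXY leqnn.
Qed.

(** * Counting bases *)

(** Points are added at the front of the list; each must avoid the span of
    those already present, and the size of that span is known. *)
Lemma count_extensions X s k : is_flat L X -> span s \subset X -> indep s ->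
  \sum_(t : k.-tuple T) (indep (t ++ s) && ([set:: t] \subset X) : nat)
    = \prod_(i < k) (#|X| - gauss q (size s + i)).
Proof.
move=> fX sX is'; elim: k => [|k IH].
  rewrite (sum_tuple0 (fun t => indep (t ++ s) && ([set:: t] \subset X) : nat)).
  by rewrite big_ord0 is' set_nil sub0set.
rewrite (sum_tupleS _ (fun t => indep (t ++ s) && ([set:: t] \subset X) : nat)).
rewrite exchange_big big_ord_recr /= -IH big_distrl /=; apply: eq_bigr => t _.
have [/andP[it tX]|it] := boolP (indep (t ++ s) && _); last first.
  rewrite mul0n big1 // => x _; rewrite indep_cons set_cons subUset -andbA.
  move: it; rewrite negb_and => /orP[]/negbTE->; rewrite !(andbF, andFb) //.
rewrite mul1n -[k in gauss _ (_ + k)](size_tuple t) addnC -size_cat -(eqP it).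
have sub : span (t ++ s) \subset X.
  rewrite span_cat flat_gen_min // subUset sX andbT; exact: flat_gen_min.
rewrite -[in RHS](setIidPr sub) -cardsD -sum1_card [RHS]big_mkcond /=.
apply: eq_bigr => x _; rewrite indep_cons it set_cons subUset sub1set tX inE !andbT.
by case: (_ && _).
Qed.

(** The number of ordered bases of a flat of rank [k]. *)
Definition bases k := \prod_(i < k) (gauss q k - gauss q i).

(** A spanning tuple of length [rank L X] is automatically independent. *)
Lemma count_bases X : is_flat L X ->
  \sum_(t : (rank L X).-tuple T) (span t == X : nat) = bases (rank L X).
Proof.
move=> fX; have := @count_extensions X [::] (rank L X) fX.
rewrite indep_nil /span set_nil flat_gen0 sub0set => /(_ isT isT).
rewrite card_flat // => E; rewrite -[RHS]E.
apply: eq_bigr => t _; congr nat_of_bool; rewrite cats0.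
apply/eqP/andP => [e|[it tX]].
  rewrite indep_rank size_tuple [span t]e eqxx; split=> //.
  by have := sub_flat_gen L [set:: t]; rewrite e.
apply/eqP; rewrite eqEcard flat_gen_min //= card_flat // (eqP it) size_tuple.
by rewrite leqnn.
Qed.

(** * Bases adapted to a sequence of flats *)

Fixpoint adapted (al : seq {set T}) s : bool :=
  if al is a :: al' then
    (span (take (rank L a) s) == a) && adapted al' (drop (rank L a) s)
  else true.

Definition ranks (al : seq {set T}) := \sum_(a <- al) rank L a.
(** [join_seq] for lists, which can be processed one flat at a time. *)
Definition join (al : seq {set T}) := cl (\bigcup_(a <- al) a).

Lemma adapted_cat al s t : ranks al <= size s -> adapted al (s ++ t) = adapted al s.
Proof.
elim: al s => //= a al IH s; rewrite /ranks big_cons => le_s.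
have le_a : rank L a <= size s := leq_trans (leq_addr _ _) le_s.
have -> : drop (rank L a) (s ++ t) = drop (rank L a) s ++ t.
  by rewrite drop_cat; case: ltngtP le_a => //= -> _; rewrite subnn drop0 drop_size.
by rewrite takel_cat // IH // size_drop leq_subRL.
Qed.

Lemma adapted_span al s : size s = ranks al -> adapted al s -> span s = join al.
Proof.
rewrite /ranks /join; elim: al s => [|a al IH] s /=.
  by rewrite !big_nil /span => /size0nil-> _; rewrite set_nil.
rewrite !big_cons => sz /andP[/eqP sa /IH].
rewrite size_drop sz addKn => /(_ erefl) sd.
by rewrite -[s in LHS](cat_take_drop (rank L a)) span_cat sa sd flat_genUr.
Qed.

Lemma count_adapted al : all (is_flat L) al ->
  \sum_(t : (ranks al).-tuple T) (adapted al t : nat)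
    = \prod_(a <- al) bases (rank L a).
Proof.
elim: al => [|a al IH] /=.
  by move=> _; rewrite /ranks !big_nil; apply: (sum_tuple0 (fun=> 1)).
move=> /andP[fa fal]; rewrite big_cons -count_bases // -(IH fal) big_distrl /=.
have -> : ranks (a :: al) = rank L a + ranks al by rewrite /ranks big_cons.
rewrite (sum_tupleD _ _ (fun t => adapted (a :: al) t : nat)).
apply: eq_bigr => u _; rewrite big_distrr; apply: eq_bigr => v _ /=.
by rewrite take_size_cat ?size_tuple // drop_size_cat ?size_tuple // mulnb.
Qed.

(** The Meshalkin condition on the ranks is what makes every concatenation of
    bases of the flats independent: its length is the rank of its span.  So all
    of them can be extended to bases of the geometry, and equally often. *)
Lemma count_adapted_bases al : all (is_flat L) al -> rank L (join al) = ranks al ->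
  \sum_(t : n.-tuple T) (indep t && adapted al t : nat)
    = (\prod_(a <- al) bases (rank L a)) *
      \prod_(i < n - ranks al) (gauss q n - gauss q (ranks al + i)).
Proof.
move=> fal ral; have fj : is_flat L (join al) := flat_gen_flat L _.
have Rn : ranks al <= n by rewrite -ral rank_le.
rewrite -count_adapted // big_distrl /=.
have <- : \sum_(t : (ranks al + (n - ranks al)).-tuple T)
             (indep t && adapted al t : nat)
   = \sum_(t : n.-tuple T) (indep t && adapted al t : nat) by rewrite subnKC.
rewrite (sum_tupleD _ _ (fun t => indep t && adapted al t : nat)).
apply: eq_bigr => u _.
have [au|au] := boolP (adapted al u); last first.
  rewrite mul0n big1 // => v _.
  by rewrite adapted_cat ?size_tuple // (negbTE au) andbF.
have su : span u = join al by apply: adapted_span; rewrite ?size_tuple.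
have iu : indep u by rewrite indep_rank su ral size_tuple.
rewrite mul1n -card_points -cardsT -[ranks al in RHS](size_tuple u).
rewrite -count_extensions ?subsetT ?flat_setT // size_tuple; apply: eq_bigr => v _.
rewrite adapted_cat ?size_tuple // au andbT subsetT andbT.
by rewrite (indep_perm (permEl (perm_catC u v))).
Qed.

Lemma count_bases_all : \sum_(t : n.-tuple T) (indep t : nat) = bases n.
Proof.
have r0 : rank L (join [::]) = ranks [::].
  rewrite /join /ranks !big_nil flat_gen0; apply/eqP; rewrite eqn_leq leq0n andbT.
  by rewrite -(leq_gauss _ _ q_gt0) -card_flat ?flat_set0 // cards0 gauss0.
have := @count_adapted_bases [::] isT r0; rewrite /ranks !big_nil mul1n subn0 => E.
by rewrite -[RHS]E; apply: eq_bigr => t _; rewrite andbT.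
Qed.

(** * Flats to which one basis is adapted *)

Definition chain_free (l : nat) (F : {set {set T}}) :=
  forall C : {set {set T}}, C \subset F -> ~~ is_chain_of_length l C.

Lemma card_chain (l : nat) (F C : {set {set T}}) : chain_free l F -> C \subset F ->
  {in C &, forall X Y, (X \subset Y) || (Y \subset X)} -> #|C| <= l.
Proof.
move=> cf CF chC; rewrite leqNgt; apply/negP => lC.
pose D := [set:: take l.+1 (enum C)].
have DC : D \subset C.
  by apply/subsetP => X; rewrite inE => /mem_take; rewrite mem_enum.
have := cf D (subset_trans DC CF); apply/negP; rewrite negbK /is_chain_of_length.
rewrite cardsE (card_uniqP _) ?take_uniq ?enum_uniq // size_takel -?cardE // eqxx /=.
apply/forall_inP => X /(subsetP DC) XC; apply/forall_inP => Y /(subsetP DC) YC.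
exact: chC.
Qed.

(** The flats in [F] spanned by initial segments of [s] form a chain, so at
    most [l] of them can come first; each leaves a fixed remainder of [s] for
    the flats that follow. *)
Lemma card_adapted (l : nat) (Fs : seq {set {set T}}) s :
  (forall F : {set {set T}}, F \in Fs -> chain_free l F) ->
  \sum_(al : (size Fs).-tuple {set T})
     (all2 (fun a (F : {set {set T}}) => a \in F) al Fs && adapted al s : nat)
    <= l ^ size Fs.
Proof.
elim: Fs s => [|F Fs IH] s cf.
  by rewrite /= (sum_tuple0 (fun al => all2 _ al [::] && adapted al s : nat)).
rewrite /= (sum_tupleS _ (fun al => all2 _ al (F :: Fs) && adapted al s : nat)).
rewrite /= expnS.
pose C := [set a in F | span (take (rank L a) s) == a].
have CF : C \subset F by apply/subsetP => a; rewrite inE => /andP[].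
have {CF} C_le : #|C| <= l.
  apply: (card_chain (cf F _) CF); rewrite ?mem_head // => a b; rewrite !inE.
  move=> /andP[_ /eqP <-] /andP[_ /eqP <-].
  move: (rank _ a) (rank _ b) => i j.
  wlog le_ij : i j / i <= j.
    by case: (leqP i j) => [|/ltnW] h H; [|rewrite orbC]; apply: H.
  apply/orP; left; apply: flat_genS; apply/subsetP => x; rewrite !inE.
  by rewrite -(cat_take_drop i (take j s)) take_takel // mem_cat => ->.
apply: leq_trans (leq_mul C_le (leqnn _)).
rewrite -sum_nat_const [X in _ <= X]big_mkcond /=.
apply: leq_sum => a _; rewrite inE.
have [aF|aF] := boolP (a \in F); last by rewrite big1.
have [sa|sa] := boolP (span _ == a); last by rewrite big1 // => v _; rewrite andbF.
by apply: IH => G GF; apply: cf; rewrite inE GF orbT.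
Qed.

Lemma card_adapted_family p (l : nat) (M : {set {ffun 'I_p -> {set T}}}) s :
  (forall k, chain_free l (component M k)) ->
  \sum_(a in M) (adapted [seq a k | k <- enum 'I_p] s : nat) <= l ^ p.
Proof.
move=> cf; pose Fs := [seq component M k | k <- enum 'I_p].
have sF : size Fs = p by rewrite size_map size_enum_ord.
have := @card_adapted l Fs s; rewrite sF => H; apply: leq_trans (H _); last first.
  by move=> F /mapP[k _ ->].
pose h (a : {ffun 'I_p -> {set T}}) := [tuple a k | k < p].
rewrite (reindex h) /=; last first.
  exists (fun t : p.-tuple {set T} => [ffun k => tnth t k]) => [a|t] _.
    by apply/ffunP => k; rewrite ffunE tnth_mktuple.
  by apply: eq_from_tnth => k; rewrite tnth_mktuple ffunE.
rewrite big_mkcond; apply: leq_sum => a _; case: ifP => // aM.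
case: adapted; rewrite ?andbF // andbT.
suff -> : all2 (fun (a : {set T}) (F : {set {set T}}) => a \in F)
            [seq a k | k <- enum 'I_p] Fs by [].
rewrite /Fs; elim: (enum _) => //= k ks ->; rewrite andbT.
by apply/imsetP; exists a.
Qed.

(** Both sides bound the number of pairs of a member of [M] and a basis adapted
    to it: the left one counts them by members, the right one by bases. *)
Lemma sum_adapted_bases p (l : nat) (M : {set {ffun 'I_p -> {set T}}}) :
  (forall a, a \in M -> partial_meshalkin L a) ->
  (forall k, chain_free l (component M k)) ->
  \sum_(a in M) (\prod_(k < p) bases (rank L (a k))) *
      \prod_(i < n - rank L (join_seq L a))
         (gauss q n - gauss q (rank L (join_seq L a) + i))
   <= l ^ p * bases n.
Proof.
move=> mM cf.
pose al (a : {ffun 'I_p -> {set T}}) := [seq a k | k <- enum 'I_p].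
rewrite (eq_bigr (fun a =>
  \sum_(t : n.-tuple T) (indep t && adapted (al a) t : nat))) => [|a aM]; last first.
  have [fa ra] := mM a aM.
  have eR : ranks (al a) = rank L (join_seq L a).
    by rewrite ra /ranks big_map big_enum.
  rewrite count_adapted_bases.
  - by rewrite eR big_map big_enum.
  - by apply/allP => X /mapP[k _ ->].
  - by rewrite eR /join big_map big_enum.
rewrite exchange_big -count_bases_all big_distrr; apply: leq_sum => t _ /=.
case: (indep t) => /=; last by rewrite big1.
by rewrite muln1; exact: card_adapted_family.
Qed.

End Geometry.

(** * The fraction of bases adapted to a sequence *)

Lemma gaussD q j k : gauss q (j + k) = gauss q j + q ^ j * gauss q k.
Proof.
rewrite /gauss big_split_ord /= big_distrr; congr (_ + _).
by apply: eq_bigr => i _; rewrite expnD.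
Qed.

(** The q-factorial divided by [(q - 1) ^ k], a natural number. *)
Definition gauss_fact q k := \prod_(i < k) gauss q i.+1.

Lemma basesE q k : bases q k = q ^ 'C(k, 2) * gauss_fact q k.
Proof.
have -> : bases q k = \prod_(i < k) (q ^ i * gauss q (k - i)).
  apply: eq_bigr => i _.
  have := gaussD q i (k - i); rewrite subnKC ?(ltnW (ltn_ord i)) // => ->.
  by rewrite addKn.
rewrite big_split /= -bin2_sum big_mkord expn_sum; congr (_ * _).
rewrite (reindex_inj rev_ord_inj); apply: eq_bigr => i _ /=.
by rewrite subKn.
Qed.

Lemma prod_extensions q n R : R <= n ->
  \prod_(i < n - R) (gauss q n - gauss q (R + i))
    = q ^ (R * (n - R)) * bases q (n - R).
Proof.
move=> Rn; rewrite expnM -[X in _ ^ X](card_ord (n - R)) -prod_nat_const -big_split.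
by apply: eq_bigr => i _ /=; rewrite -{1}(subnKC Rn) !gaussD subnDl mulnBr.
Qed.

Lemma bin2D j k : 'C(j + k, 2) = 'C(j, 2) + 'C(k, 2) + j * k.
Proof.
elim: k => [|k IH]; first by rewrite addn0 muln0 bin0n !addn0.
by rewrite addnS (binS (j + k)) (binS k) !bin1 IH mulnS; lia.
Qed.

Lemma s2_recr t (alpha : 'I_t.+1 -> nat) :
  s2 alpha = s2 (fun i => alpha (widen_ord (leqnSn t) i))
    + (\sum_(i < t) alpha (widen_ord (leqnSn t) i)) * alpha ord_max.
Proof.
rewrite /s2 big_ord_recr /= [X in _ + X]big1 => [|j]; last first.
  by rewrite ltnNge -ltnS ltn_ord.
rewrite addn0 big_distrl -big_split /=; apply: eq_bigr => i _.
by rewrite big_mkcond big_ord_recr /= ltn_ord -big_mkcond.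
Qed.

Lemma bin2_sum_s2 t (alpha : 'I_t -> nat) :
  'C(\sum_(i < t) alpha i, 2) = \sum_(i < t) 'C(alpha i, 2) + s2 alpha.
Proof.
elim: t alpha => [|t IH] alpha; first by rewrite /s2 !big_ord0.
by rewrite s2_recr !big_ord_recr /= bin2D IH -!addnA; congr (_ + _); rewrite addnCA.
Qed.

Local Open Scope ring_scope.

Lemma gauss_rat q k : (q%:R - 1) * (gauss q k)%:R = q%:R ^+ k - 1 :> rat.
Proof.
rewrite subrX1 /gauss natr_sum; congr (_ * _).
by apply: eq_bigr => i _; rewrite natrX.
Qed.

Lemma qfactE q k : qfact q k = (q%:R - 1) ^+ k * (gauss_fact q k)%:R.
Proof.
rewrite /qfact big_add1 big_mkord /gauss_fact natr_prod.
rewrite -[X in (_ - _) ^+ X](card_ord k).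
rewrite -prodr_const -big_split; apply: eq_bigr => i _ /=.
by rewrite gauss_rat.
Qed.

Lemma gauss_fact_gt0 q k : (0 < q)%N -> (0 < gauss_fact q k)%N.
Proof.
by move=> q0; apply: prodn_gt0 => i; rewrite gaussS.
Qed.

Lemma qfact_gt0 q k : (1 < q)%N -> 0 < qfact q k.
Proof.
move=> q1; rewrite qfactE mulr_gt0 ?ltr0n ?gauss_fact_gt0 ?(ltnW q1) //.
by rewrite exprn_gt0 // subr_gt0 ltr1n.
Qed.

Lemma bases_gt0 q k : (0 < q)%N -> (0 < bases q k)%N.
Proof. by move=> q0; rewrite basesE muln_gt0 expn_gt0 q0 gauss_fact_gt0. Qed.

Lemma qmultinom_partial q n p (r : 'I_p -> nat) R : (1 < q)%N ->
  qbinom q n R * qmultinom q R r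
    = qfact q n / (qfact q (n - R) * \prod_(k < p) qfact q (r k)).
Proof.
move=> q1; rewrite /qbinom /qmultinom.
have RN := lt0r_neq0 (qfact_gt0 R q1); have nRN := lt0r_neq0 (qfact_gt0 (n - R) q1).
have rN : \prod_(k < p) qfact q (r k) != 0.
  by apply/prodf_neq0 => k _; apply/lt0r_neq0/qfact_gt0.
by field; rewrite RN nRN rN.
Qed.

(** The factors [gauss_fact] and the powers of [q - 1] cancel; what remains is
    to compare the exponents of [q], which is done by splitting ['C(n, 2)]
    along [n = r 0 + ... + r (p - 1) + (n - R)]. *)
Lemma weightE q n p (r : 'I_p -> nat) R : (1 < q)%N -> (R <= n)%N ->
  R = (\sum_(k < p) r k)%N ->
  ((\prod_(k < p) bases q (r k)) * (q ^ (R * (n - R)) * bases q (n - R)))%:R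
   * (qbinom q n R * qmultinom q R r * q%:R ^+ s2 r) = (bases q n)%:R :> rat.
Proof.
move=> q1 Rn ER; rewrite qmultinom_partial //.
have EC : 'C(n, 2)
    = ((\sum_(k < p) 'C(r k, 2)) + R * (n - R) + 'C(n - R, 2) + s2 r)%N.
  by rewrite -{1}(subnKC Rn) bin2D {1}ER bin2_sum_s2; lia.
have -> : (\prod_(k < p) bases q (r k))%N
    = (q ^ (\sum_(k < p) 'C(r k, 2)) * \prod_(k < p) gauss_fact q (r k))%N.
  by rewrite expn_sum -big_split; apply: eq_bigr => k _; rewrite basesE.
have -> : \prod_(k < p) qfact q (r k)
    = (q%:R - 1) ^+ R * (\prod_(k < p) gauss_fact q (r k))%N%:R :> rat.
  rewrite ER -prodrXr natr_prod -big_split /=.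
  by apply: eq_bigr => k _; rewrite qfactE.
rewrite !basesE EC !qfactE -[in (_ - 1) ^+ n](subnKC Rn) !natrM !natrX !exprD.
set G := (\prod_(k < p) gauss_fact q (r k))%N%:R.
have GN : G != 0 :> rat.
  by rewrite pnatr_eq0 -lt0n; apply: prodn_gt0 => k; rewrite gauss_fact_gt0 // ltnW.
have HN : (gauss_fact q (n - R))%:R != 0 :> rat.
  by rewrite pnatr_eq0 -lt0n gauss_fact_gt0 // ltnW.
have qN k : (q%:R - 1) ^+ k != 0 :> rat.
  by rewrite expf_neq0 // subr_eq0 pnatr_eq1 gtn_eqF.
move: (qN R) (qN (n - R)%N) HN GN => {qN}.
move: ((q%:R - 1) ^+ R) ((q%:R - 1) ^+ (n - R)) => a b aN bN.
set c := (gauss_fact q (n - R))%:R => cN dN.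
by field; rewrite aN bN cN dN.
Qed.

(** * Sums of largest values *)

(** Compare every value with the largest value [c] outside the [N] selected
    ones.  The weight outside is at most [N] minus the weight of the selected
    indices, that is, the total deficit [1 - y i] of the latter; moving it onto
    them replaces values at most [c] by values at least [c]. *)
Lemma ler_sum_largest (I : eqType) (s : seq I) (v y : I -> rat) N :
  (forall i, i \in s -> 0 <= v i) ->
  (forall i, i \in s -> 0 <= y i <= 1) -> \sum_(i <- s) y i <= N%:R ->
  \sum_(i <- s) y i * v i <= sum_largest N [seq v i | i <- s].
Proof.
move=> v0 y01 sy; rewrite /sum_largest sort_map -map_take big_map.
set s' := sort _ s; have ss : perm_eq s' s by rewrite perm_sort.
have in_s i : i \in s' -> i \in s by rewrite (perm_mem ss).
have : sorted (relpre v (fun x y => y <= x)) s'.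
  by apply: sort_sorted => i j; apply: le_total.
rewrite sorted_pairwise => [|i j k /= vij vjk]; last exact: le_trans vjk vij.
rewrite -(perm_big _ ss) /= in sy; rewrite -(perm_big _ ss) /=.
have st : size (take N s') = N \/ drop N s' = [::].
  case: (leqP N (size s')) => h; [left; exact: size_takel | right].
  by apply: drop_oversize; apply: ltnW.
have {}in_s i : i \in take N s' ++ drop N s' -> i \in s.
  by rewrite cat_take_drop; apply: in_s.
rewrite -[s' in X in X -> _](cat_take_drop N) pairwise_cat.
move=> /and3P[/allrelP tdv _ dd].
rewrite -[s' in \sum_(i <- s') _](cat_take_drop N) big_cat /= in sy.
rewrite -[s' in X in X <= _](cat_take_drop N) big_cat /=.
move: (take N s') (drop N s') st in_s tdv dd sy => t d st in_s tdv dd sy.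
have tP i : i \in t -> 0 <= v i /\ 0 <= y i <= 1.
  move=> it; have /in_s i_s : i \in t ++ d by rewrite mem_cat it.
  by split; [exact: v0 | exact: y01].
have dP i : i \in d -> 0 <= v i /\ 0 <= y i <= 1.
  move=> it; have /in_s i_s : i \in t ++ d by rewrite mem_cat it orbT.
  by split; [exact: v0 | exact: y01].
case: d st in_s tdv dd sy dP => [|m d] st _ tdv dd sy dP.
  rewrite big_nil addr0 big_seq [leRHS]big_seq.
  apply: ler_sum => i /tP[vi /andP[_ yi]].
  by rewrite ler_piMl.
case: st => // st; move: dd => /= /andP[/allP dm _].
have cd i : i \in m :: d -> v i <= v m by rewrite inE => /orP[/eqP->//|/dm].
have [c0 _] := dP m (mem_head _ _).
have md : \sum_(i <- m :: d) y i * v i <= \sum_(i <- m :: d) y i * v m.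
  rewrite big_seq [leRHS]big_seq; apply: ler_sum => i id.
  by rewrite ler_wpM2l ?cd //; case: (dP i id) => _ /andP[].
have td : \sum_(i <- t) (1 - y i) * v m <= \sum_(i <- t) (1 - y i) * v i.
  rewrite big_seq [leRHS]big_seq; apply: ler_sum => i it.
  rewrite ler_wpM2l ?subr_ge0; [by []|by case: (tP i it) => _ /andP[]|].
  exact: (tdv i m it (mem_head _ _)).
have e1 : \sum_(i <- t) (1 - y i) * v m = (N%:R - \sum_(i <- t) y i) * v m.
  by rewrite -mulr_suml sumrB big_const_seq count_predT iter_addr_0 st.
have e2 : \sum_(i <- t) (1 - y i) * v i
    = \sum_(i <- t) v i - \sum_(i <- t) y i * v i.
  by rewrite -sumrB; apply: eq_bigr => i _; rewrite mulrBl mul1r.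
rewrite e1 e2 in td; rewrite -mulr_suml in md.
have := ler_wpM2r c0 sy; rewrite mulrDl; lra.
Qed.

(** * The two inequalities *)

Section Main.
Variables (p q n : nat) (T : finType) (L : {set {set T}}).
Hypotheses (q_gt1 : (1 < q)%N) (pg : is_projective_geometry L q n).
Implicit Types (M : {set {ffun 'I_p -> {set T}}}) (a : {ffun 'I_p -> {set T}}).

(** The number of all partial Meshalkin sequences with the ranks of [a]. *)
Definition num_type a : rat :=
  qbinom q n (rank L (join_seq L a)) *
  qmultinom q (rank L (join_seq L a)) (rank_seq L a) *
  q%:R ^+ s2 (rank_seq L a).

Lemma num_type_gt0 a : 0 < num_type a.
Proof.
rewrite /num_type /qbinom /qmultinom !mulr_gt0 ?invr_gt0 ?mulr_gt0 ?qfact_gt0 //.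
  by apply: prodr_gt0 => k _; apply: qfact_gt0.
by rewrite exprn_gt0 // ltr0n ltnW.
Qed.

Lemma lym l M :
  (forall a, a \in M -> partial_meshalkin L a) ->
  (forall k, chain_free l (component M k)) ->
  \sum_(a in M) 1 / num_type a <= (l ^ p)%:R.
Proof.
move=> mM cf; have B0 : 0 < (bases q n)%:R :> rat.
  by rewrite ltr0n bases_gt0 // ltnW.
rewrite -(ler_pM2r B0) mulr_suml -natrM.
apply: le_trans (_ : _ <= _%:R) _; last first.
  by rewrite ler_nat; exact: (sum_adapted_bases q_gt1 pg mM cf).
rewrite natr_sum; apply: ler_sum => a aM; have [fa ra] := mM a aM.
have Rn : (rank L (join_seq L a) <= n)%N.
  by rewrite (rank_le q_gt1 pg) // flat_gen_flat.
rewrite prod_extensions // -(weightE q_gt1 Rn ra) mulrC -/(num_type a) div1r.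
by rewrite mulfK // lt0r_neq0 ?num_type_gt0.
Qed.

(** The ranks of [a], followed by the rank of a complement of its join. *)
Definition full_type a : {ffun 'I_p.+1 -> 'I_n.+1} :=
  [ffun i => inord (if unlift ord_max i is Some k then rank L (a k)
                    else n - rank L (join_seq L a))].

(** The number of Meshalkin sequences with ranks [alpha] whose join is the whole
    geometry. *)
Definition num_full (alpha : {ffun 'I_p.+1 -> 'I_n.+1}) : rat :=
  qmultinom q n (fun i => nat_of_ord (alpha i)) *
  q%:R ^+ s2 (fun i => nat_of_ord (alpha i)).

Lemma full_type_last a : full_type a ord_max = (n - rank L (join_seq L a))%N :> nat.
Proof. by rewrite ffunE unlift_none inordK // ltnS leq_subr. Qed.

Lemma full_type_rank a k : is_flat L (a k) ->
  full_type a (widen_ord (leqnSn p) k) = rank L (a k) :> nat.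
Proof.
move=> fa; have -> : widen_ord (leqnSn p) k = lift ord_max k.
  by apply: val_inj; rewrite /= /bump leqNgt ltn_ord.
by rewrite ffunE liftK inordK // ltnS (rank_le q_gt1 pg).
Qed.

Lemma full_type_comp a :
  partial_meshalkin L a -> full_type a \in compositions p.+1 n.
Proof.
move=> [fa ra]; rewrite inE big_ord_recr /= full_type_last.
rewrite (eq_bigr (fun k => rank L (a k))) => [|k _]; last exact: full_type_rank.
by rewrite -ra subnKC // (rank_le q_gt1 pg) // flat_gen_flat.
Qed.

Lemma num_full_gt0 alpha : 0 < num_full alpha.
Proof.
rewrite /num_full /qmultinom mulr_gt0 ?mulr_gt0 ?invr_gt0 ?qfact_gt0 //.
  by apply: prodr_gt0 => k _; apply: qfact_gt0.
by rewrite exprn_gt0 // ltr0n ltnW.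
Qed.

(** The two numbers differ by [q ^ (r * (n - r))], the number of complements of
    a flat of rank [r]. *)
Lemma num_type_le_full a :
  partial_meshalkin L a -> num_type a <= num_full (full_type a).
Proof.
move=> [fa ra]; rewrite /num_type qmultinom_partial // /num_full /qmultinom.
rewrite big_ord_recr /= full_type_last s2_recr exprD mulrA.
have -> : \prod_(i < p) qfact q (full_type a (widen_ord (leqnSn p) i))
   = \prod_(k < p) qfact q (rank_seq L a k).
  by apply: eq_bigr => k _; rewrite full_type_rank.
have -> : s2 (fun i => full_type a (widen_ord (leqnSn p) i) : nat)
   = s2 (rank_seq L a).
  by apply: eq_bigr => i _; apply: eq_bigr => j _; rewrite !full_type_rank.
rewrite [X in _ / X]mulrC ler_peMr //; last first.
  by rewrite exprn_ege1 // ler1n ltnW.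
rewrite mulr_ge0 ?exprn_ge0 ?ler0n // divr_ge0 ?mulr_ge0 ?ltW ?qfact_gt0 //.
by apply: prodr_gt0 => k _; apply: qfact_gt0.
Qed.

Lemma chain_free1_type M alpha k :
  (forall a, a \in M -> partial_meshalkin L a) ->
  chain_free 1 (component [set a in M | full_type a == alpha] k).
Proof.
move=> mM C CM; apply/negP; rewrite /is_chain_of_length.
move=> /andP[/cards2P[X [Y [XY eC]]] /forall_inP chC].
have H Z : Z \in C -> is_flat L Z /\ rank L Z = alpha (widen_ord (leqnSn p) k).
  move=> /(subsetP CM)/imsetP[a]; rewrite inE => /andP[/mM[fa _] /eqP<-] ->.
  by rewrite full_type_rank.
have XC : X \in C by rewrite eC !inE eqxx.
have YC : Y \in C by rewrite eC !inE eqxx orbT.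
have [[fX rX] [fY rY]] := (H X XC, H Y YC).
move/negP: XY; apply; apply/eqP.
have /forall_inP/(_ Y YC)/orP[h|h] := chC X XC.
  by apply: (rank_inj q_gt1 pg) => //; rewrite rX.
by apply/esym/(rank_inj q_gt1 pg) => //; rewrite rX.
Qed.

Lemma card_le_sum_largest l M :
  (forall a, a \in M -> partial_meshalkin L a) ->
  (forall k, chain_free l (component M k)) ->
  #|M|%:R <= sum_largest (l ^ p)
               [seq num_full alpha | alpha in compositions p.+1 n].
Proof.
move=> mM cf; pose Mt alpha := [set a in M | full_type a == alpha].
have inv_le a : a \in M -> (num_full (full_type a))^-1 <= 1 / num_type a.
  move=> /mM ma; rewrite div1r lef_pV2 ?posrE ?num_full_gt0 ?num_type_gt0 //.
  exact: num_type_le_full.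
pose y alpha := #|Mt alpha|%:R / num_full alpha.
have yE alpha : y alpha = \sum_(a in Mt alpha) (num_full (full_type a))^-1.
  rewrite /y -sum1_card natr_sum mulr_suml; apply: eq_bigr => a.
  by rewrite inE => /andP[_ /eqP->]; rewrite mul1r.
have part (F : _ -> rat) : \sum_(a in M) F a
    = \sum_(alpha in compositions p.+1 n) \sum_(a in Mt alpha) F a.
  rewrite (partition_big full_type (mem (compositions p.+1 n))) /=; last first.
    by move=> a /mM; exact: full_type_comp.
  by apply: eq_bigr => alpha _; apply: eq_bigl => a; rewrite inE.
have -> : #|M|%:R
    = \sum_(alpha <- enum (compositions p.+1 n)) y alpha * num_full alpha.
  rewrite big_enum /= -sum1_card natr_sum part; apply: eq_bigr => alpha _.
  by rewrite /y mulfVK ?lt0r_neq0 ?num_full_gt0 // -natr_sum sum1_card.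
apply: ler_sum_largest => [alpha _|alpha _|].
- exact/ltW/num_full_gt0.
- rewrite divr_ge0 ?ler0n ?(ltW (num_full_gt0 _)) //= yE.
  have mMt a : a \in Mt alpha -> partial_meshalkin L a by rewrite inE => /andP[/mM].
  have := lym mMt (fun k => @chain_free1_type M alpha k mM); rewrite exp1n.
  apply: le_trans; apply: ler_sum => a; rewrite inE => /andP[aM _]; exact: inv_le.
- rewrite big_enum /=; apply: le_trans (lym mM cf).
  rewrite part; apply: ler_sum => alpha _; rewrite yE.
  by apply: ler_sum => a; rewrite inE => /andP[aM _]; exact: inv_le.
Qed.

End Main.

Theorem corollary11 (p l q n : nat) (T : finType) (L : {set {set T}})
    (M : {set {ffun 'I_p -> {set T}}}) :
  (1 <= p)%N -> (1 <= l)%N -> (2 <= q)%N ->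
  is_projective_geometry L q n ->
  (forall a : {ffun 'I_p -> {set T}}, a \in M -> partial_meshalkin L a) ->
  (forall (k : 'I_p) (C : {set {set T}}),
     C \subset component M k -> ~~ is_chain_of_length l C) ->
  (\sum_(a in M)
     1 / (qbinom q n (rank L (join_seq L a)) *
          qmultinom q (rank L (join_seq L a)) (rank_seq L a) *
          q%:R ^+ s2 (rank_seq L a))
   <= (l ^ p)%:R :> rat) /\
  (#|M|%:R <=
     sum_largest (l ^ p)
       [seq qmultinom q n (fun i => nat_of_ord (alpha i)) *
            q%:R ^+ s2 (fun i => nat_of_ord (alpha i))
       | alpha : {ffun 'I_p.+1 -> 'I_n.+1} in compositions p.+1 n] :> rat).
Proof.
move=> _ _ q1 pg mM cf; split; first exact: (lym q1 pg mM cf).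
exact: (card_le_sum_largest q1 pg mM cf).
Qed.
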